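(* Let $(P_n)_{n\ge0}$ and $(Q_n)_{n\ge0}$ be two monic orthogonal polynomial sequences (MOPSs) with respect to the regular functionals $\mathbf u$ and $\mathbf v$, respectively, normalized by $\langle\mathbf u,1\rangle=1=\langle\mathbf v,1\rangle$. Let $(\beta_n,\gamma_{n+1})_{n\ge0}$ and $(\widetilde\beta_n,\widetilde\gamma_{n+1})_{n\ge0}$ be the corresponding sets of recurrence coefficients of $(P_n)_n$ and $(Q_n)_n$, respectively. Suppose that $(P_n)_n$ and $(Q_n)_n$ are linked by a non-degenerate $2-3$ type relation $$Q_n(x)+r_nQ_{n-1}(x)=P_n(x)+s_nP_{n-1}(x)+t_nP_{n-2}(x),\qquad n\ge0,$$ where $(r_n)_{n\ge0}$, $(s_n)_{n\ge0}$, $(t_n)_{n\ge0}$ are sequences of complex numbers with $r_0=s_0=t_0=t_1=0$, non-degeneracy meaning that $t_2\ne r_2(s_1-r_1)$ and $r_nt_n\neq0$ for all $n\ge3$; therefore the functionals are related by $$\lambda(x-c)\mathbf u=(x^2+ax+b)\mathbf v$$ for some complex numbers $\lambda\neq0$, $a$, $b$, $c$. Let $A$, $B$, $C$ be the constant values of the following three sequences, which do not depend on $n\ge3$: $$A=\frac{s_na_{n+1}}{t_{n+1}}-\beta_{n-1}-\beta_n+s_{n+1},$$ $$B=\frac{a_na_{n+1}}{t_{n+1}}+(s_n-\beta_{n-1})\left(\frac{s_na_{n+1}}{t_{n+1}}-\beta_n-s_n+s_{n+1}\right)+t_n-a_n-\gamma_{n-1},$$ $$C=\widetilde\beta_n-r_{n+1}-\frac{\widetilde\gamma_n}{r_n},$$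 where $a_n:=\gamma_n+t_n-t_{n+1}+s_n(s_{n+1}-s_n-\beta_n+\beta_{n-1})$ for $n\ge1$. Then $$A=a,\qquad B=b,\qquad C=c.$$
   Context: A functional here is a linear functional $\mathbf w$ on the space of complex polynomials in one variable; $\langle\mathbf w,p\rangle$ is its value at $p$. For a polynomial $\phi$, the functional $\phi\mathbf w$ is defined by $\langle\phi\mathbf w,p\rangle=\langle\mathbf w,\phi p\rangle$. A MOPS with respect to $\mathbf w$ is a sequence $(R_n)_{n\ge0}$ of monic polynomials with $\deg R_n=n$, $\langle\mathbf w,R_nR_m\rangle=0$ for $n\ne m$ and $\langle\mathbf w,R_n^2\rangle\neq0$ for all $n$; $\mathbf w$ is regular (quasi-definite) if such a sequence exists. The recurrence coefficients of a MOPS $(R_n)_n$ are the complex numbers $\beta_n$ ($n\ge0$) and $\gamma_n\ne0$ ($n\ge1$) such that $R_{n+1}(x)=(x-\beta_n)R_n(x)-\gamma_nR_{n-1}(x)$, $n\ge0$, with $R_0=1$, $R_{-1}=0$. Polynomials with negative index are zero. In the setting of the claim, the relation $\lambda(x-c)\mathbf u=(x^2+ax+b)\mathbf v$ holds for suitable $\lambda\ne0,a,b,c$, and the three displayed sequences are constant for $n\ge3$. *)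

(* Defs.v *)
From HB Require Import structures.
From mathcomp Require Import all_boot all_order all_algebra.
From mathcomp Require Import reals complex.

Set Implicit Arguments.
Unset Strict Implicit.
Unset Printing Implicit Defensive.

Import Order.TTheory GRing.Theory Num.Theory.
Local Open Scope ring_scope.

Section OrthogonalPolynomials.
Variable F : fieldType.

(* The left product of a functional by a polynomial: <phi w, p> = <w, phi p>. *)
Definition fmul (phi : {poly F}) (w : {poly F} -> F) : {poly F} -> F :=
  fun p => w (phi * p).

Definition is_MOPS (w : {scalar {poly F}}) (S : nat -> {poly F}) : Prop :=
  [/\ forall n, S n \is monic,
      forall n, size (S n) = n.+1,
      forall n m, n != m -> w (S n * S m) = 0
    & forall n, w (S n ^+ 2) != 0].

(* lag k S n is the member S_(n-k) of the sequence, and 0 for n < k. *)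
Definition lag (k : nat) (S : nat -> {poly F}) (n : nat) : {poly F} :=
  if (k <= n)%N then S (n - k)%N else 0.

(* The value g 0 is irrelevant, since it only multiplies S_(-1) = 0. *)
Definition is_recurrence_coefs (S : nat -> {poly F}) (b g : nat -> F) : Prop :=
  (forall n, (1 <= n)%N -> g n != 0) /\
  (forall n, S n.+1 = ('X - (b n)%:P) * S n - g n *: lag 1 S n).

Definition linked23 (P Q : nat -> {poly F}) (r s t : nat -> F) : Prop :=
  [/\ r 0%N = 0, s 0%N = 0, t 0%N = 0, t 1%N = 0
    & forall n, Q n + r n *: lag 1 Q n
                = P n + s n *: lag 1 P n + t n *: lag 2 P n].

Definition nondegenerate23 (r s t : nat -> F) : Prop :=
  t 2%N != r 2%N * (s 1%N - r 1%N) /\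
  (forall n, (3 <= n)%N -> r n * t n != 0).

Definition functionals_related
    (u v : {poly F} -> F) (lambda a b c : F) : Prop :=
  lambda != 0 /\
  (forall p, lambda * fmul ('X - c%:P) u p
             = fmul ('X^2 + a *: 'X + b%:P) v p).

Definition seq_a (be ga s t : nat -> F) (n : nat) : F :=
  ga n + t n - t n.+1 + s n * (s n.+1 - s n - be n + be n.-1).

Definition seq_A (be ga s t : nat -> F) (n : nat) : F :=
  s n * seq_a be ga s t n.+1 / t n.+1 - be n.-1 - be n + s n.+1.

Definition seq_B (be ga s t : nat -> F) (n : nat) : F :=
  seq_a be ga s t n * seq_a be ga s t n.+1 / t n.+1
  + (s n - be n.-1)
    * (s n * seq_a be ga s t n.+1 / t n.+1 - be n - s n + s n.+1)
  + t n - seq_a be ga s t n - ga n.-1.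

Definition seq_C (tbe tga r : nat -> F) (n : nat) : F :=
  tbe n - r n.+1 - tga n / r n.

End OrthogonalPolynomials.

(* Main.v *)
Require Import Defs.
From HB Require Import structures.
From mathcomp Require Import all_boot all_order all_algebra.
From mathcomp Require Import reals complex.
From mathcomp Require Import ring.

Set Implicit Arguments.
Unset Strict Implicit.
Unset Printing Implicit Defensive.

Import Order.TTheory GRing.Theory Num.Theory.
Local Open Scope ring_scope.

(** Write [R_n] for the two sides of the linking relation, and [phi] for
[x^2 + a x + b]. Orthogonality gives [<u, R_n> = 0] for [n >= 3], so
[<u, Q_n> = - r_n <u, Q_(n-1)>], which never vanishes for [n >= 2] because
[<u, Q_2> = t_2 - r_2 (s_1 - r_1)]. Testing [lambda (x - c) u = phi v] on the
basis [Q_0, Q_1, Q_2, R_3, R_4, ...] then reduces it to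
[lambda t_3 <u, P_1^2> = r_3 <v, Q_2^2>] and a triangular system for c, a, b.

Conversely, [<v, phi Q_n> = 0] gives the value of C, equivalently
[(x - c) Q_n = R_(n+1) + (tga_n / r_n) R_n]. With this identity, evaluating
[lambda <u, (x - c) P Q_n> = <v, phi P Q_n>] at [P = P_(n-1)] and [P = P_n]
yields the values of A and B, once [a_(n+1) / t_(n+1) = ga_(n-1) / t_n] is known;
the latter comes from the two top coefficients of [x R_(n+1) - R_(n+2)] in the
bases [P] and [Q]. *)

(** Certificate for elimination: [x' = y'] is a linear combination of known equations, and the
    remaining identity [x - y = x' - y'] is left to [ring] or [field]. *)
Lemma eq_lincomb (V : zmodType) (x y x' y' : V) :
  x' = y' -> x - y = x' - y' -> x = y.
Proof. by move=> ->; rewrite subrr => /subr0_eq. Qed.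

(** Subtracting the multiple of [S N] that cancels the coefficient of degree [N] lowers the degree,
    so the first [N] members span all polynomials of size at most [N]. *)
Lemma monic_seq_ind (F : fieldType) (S : nat -> {poly F}) (T : {poly F} -> Prop) :
    (forall n, S n \is monic) -> (forall n, size (S n) = n.+1) ->
    forall N, T 0 -> (forall a p q, T p -> T q -> T (a *: p + q)) ->
    (forall n, (n < N)%N -> T (S n)) ->
  forall p : {poly F}, (size p <= N)%N -> T p.
Proof.
move=> Sm Ss N T0 Tlin; elim: N => [|N IH] TS p lep.
  by move: lep; rewrite leqn0 size_poly_eq0 => /eqP->.
have -> : p = p`_N *: S N + (p - p`_N *: S N) by rewrite addrC subrK.
apply: Tlin; first exact: TS.
apply: IH => [n ltn|]; first by apply: TS; exact: ltnW.
apply/leq_sizeP => j; rewrite leq_eqVlt coefB coefZ => /predU1P[<-|ltj].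
  by have /monicP := Sm N; rewrite /lead_coef Ss /= => ->; rewrite mulr1 subrr.
by rewrite [p`_j]nth_default ?[(S N)`_j]nth_default ?mulr0 ?subrr ?Ss // (leq_trans lep).
Qed.

Lemma size_quadratic (F : fieldType) (a b : F) :
  size ('X^2 + a *: 'X + b%:P) = 3.
Proof.
rewrite -addrA size_polyDl size_polyXn //.
rewrite (leq_ltn_trans (size_polyD _ _)) // gtn_max.
rewrite (leq_ltn_trans (size_scale_leq _ _)) ?size_polyX //.
by rewrite (leq_ltn_trans (size_polyC_leq1 _)).
Qed.

Lemma monic_quadratic (F : fieldType) (a b : F) :
  'X^2 + a *: 'X + b%:P \is monic.
Proof.
rewrite monicE /lead_coef size_quadratic !coefD coefXn coefZ coefX coefC /=.
by rewrite mulr0 !addr0.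
Qed.

(** * Orthogonality and norms for a single MOPS *)

Section MOPS.
Variables (F : fieldType) (w : {scalar {poly F}}) (S : nat -> {poly F}).
Hypothesis hS : is_MOPS w S.

Lemma mops_size n : size (S n) = n.+1. Proof. by case: hS => _ ->. Qed.

Lemma mops_coef n : (S n)`_n = 1.
Proof. by case: hS => Sm Ss _ _; have /monicP := Sm n; rewrite /lead_coef Ss. Qed.

Lemma mops0 : S 0%N = 1.
Proof.
have /eqP/size_poly1P[c _ Sc] := mops_size 0.
by have := mops_coef 0; rewrite Sc coefC /= => ->.
Qed.

Lemma mops_orth_lt n (p : {poly F}) : (size p <= n)%N -> w (S n * p) = 0.
Proof.
case: hS => Sm Ss So _.
apply: (monic_seq_ind (T := fun p => w (S n * p) = 0) Sm Ss).
- by rewrite mulr0 linear0.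
- by move=> a q1 q2 /= q10 q20; rewrite mulrDr -scalerAr linearP q10 q20 /= mulr0 addr0.
- by move=> m ltmn; apply: So; rewrite gtn_eqF.
Qed.

Lemma mops_orth m n : (m < n)%N -> w (S n * S m) = 0.
Proof. by move=> ltmn; rewrite mops_orth_lt // mops_size. Qed.

Lemma mops_orth_le n (p : {poly F}) : (size p <= n.+1)%N -> w (S n * p) = p`_n * w (S n ^+ 2).
Proof.
move=> lep; have -> : p = p`_n *: S n + (p - p`_n *: S n) by rewrite addrC subrK.
rewrite mulrDr -scalerAr linearD scalarZ -expr2 (@mops_orth_lt _ (p - _)).
  by rewrite addr0 coefD coefB !coefZ mops_coef mulr1 subrr addr0.
apply/leq_sizeP => j; rewrite leq_eqVlt coefB coefZ => /predU1P[<-|ltj].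
  by rewrite mops_coef mulr1 subrr.
by rewrite [p`_j]nth_default ?[(S n)`_j]nth_default ?mulr0 ?subrr ?mops_size // (leq_trans lep).
Qed.

Lemma mops_orth_monic n (p : {poly F}) :
  p \is monic -> size p = n.+1 -> w (S n * p) = w (S n ^+ 2).
Proof.
move=> /monicP + sp; rewrite /lead_coef sp /= => pn.
by rewrite mops_orth_le ?sp // pn mul1r.
Qed.

Lemma mops_norm_neq0 n : w (S n ^+ 2) != 0. Proof. by case: hS => _ _ _ ->. Qed.

Variables (b g : nat -> F).
Hypothesis hrec : is_recurrence_coefs S b g.

Lemma mops_mulX n :
  'X * S n.+1 = S n.+2 + b n.+1 *: S n.+1 + g n.+1 *: S n.
Proof.
case: hrec => _ /(_ n.+1) ->; rewrite /lag /= subn1 /= mulrBl mul_polyC.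
by rewrite addrAC !subrK.
Qed.

(** Evaluate <w, x S_n S_(n+1)> twice: x S_n is monic of degree n+1, and x S_(n+1) expands by the
    recurrence. *)
Lemma mops_normS n : w (S n.+1 ^+ 2) = g n.+1 * w (S n ^+ 2).
Proof.
have sX : (size ('X * S n)%R <= n.+2)%N.
  by rewrite mulrC size_mulX -?size_poly_eq0 mops_size.
have cX : ('X * S n)`_n.+1 = 1 by rewrite coefXM /= mops_coef.
have := mops_orth_le sX; rewrite cX mul1r => <-.
rewrite mulrCA mulrA mops_mulX !mulrDl -!scalerAl !linearD !scalarZ -expr2.
by rewrite (mops_orth (ltnW (ltnSn n.+1))) (mops_orth (ltnSn n)) mulr0 !add0r.
Qed.

End MOPS.

Lemma fmul_linear (F : fieldType) (w : {scalar {poly F}}) (c : F) p :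
  w (('X - c%:P) * p) = w ('X * p) - c * w p.
Proof. by rewrite mulrBl linearB mul_polyC scalarZ. Qed.

Lemma fmul_quadratic (F : fieldType) (w : {scalar {poly F}}) (a b : F) p :
  w (('X^2 + a *: 'X + b%:P) * p) = w ('X * ('X * p)) + a * w ('X * p) + b * w p.
Proof. by rewrite !mulrDl expr2 -mulrA !linearD mul_polyC -scalerAl !scalarZ. Qed.

(** * Existence of the relation between the two functionals *)

Section Linked.
Variables (F : fieldType) (u v : {scalar {poly F}}) (P Q : nat -> {poly F}).
Variables (be ga tbe tga r s t : nat -> F).
Hypotheses (hP : is_MOPS u P) (hQ : is_MOPS v Q) (hu1 : u 1 = 1) (hv1 : v 1 = 1).
Hypotheses (hPrec : is_recurrence_coefs P be ga).
Hypotheses (hQrec : is_recurrence_coefs Q tbe tga).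
Hypotheses (hlink : linked23 P Q r s t) (hnd : nondegenerate23 r s t).

Let k n := u (P n ^+ 2).
Let K n := v (Q n ^+ 2).

Lemma linkedSS n :
  Q n.+2 + r n.+2 *: Q n.+1 = P n.+2 + s n.+2 *: P n.+1 + t n.+2 *: P n.
Proof. by case: hlink => _ _ _ _ /(_ n.+2); rewrite /lag /= !subSS !subn0. Qed.

Lemma nondeg_neq0 n : r n.+3 != 0 /\ t n.+3 != 0.
Proof. by case: hnd => _ /(_ n.+3 isT); rewrite mulf_eq0 => /norP. Qed.

Lemma mops_functional_eq0 n : u (P n.+1) = 0.
Proof. by rewrite -[P _]mulr1 (mops_orth_lt hP) // size_poly1. Qed.

Lemma functional_linked n : u (Q n.+3) = - r n.+3 * u (Q n.+2).
Proof.
have := congr1 u (linkedSS n.+1).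
rewrite !linearD !scalarZ !mops_functional_eq0 !mulr0 !addr0 => /eqP.
by rewrite addr_eq0 mulNr => /eqP.
Qed.

(** The linking relation at n = 1 gives <u, Q_1> = s_1 - r_1, which is inserted into the case n =
    2. *)
Lemma functional_linked2 : u (Q 2%N) = t 2%N - r 2%N * (s 1%N - r 1%N).
Proof.
have e1 : Q 1%N + r 1%N *: Q 0%N = P 1%N + s 1%N *: P 0%N.
  by case: hlink => _ _ _ t1 /(_ 1%N); rewrite /lag /= subnn t1 scale0r addr0.
have := congr1 u e1; rewrite !linearD !scalarZ (mops0 hP) (mops0 hQ) hu1.
rewrite mops_functional_eq0 !mulr1 add0r => uQ1.
have := congr1 u (linkedSS 0); rewrite !linearD !scalarZ (mops0 hP) hu1.
rewrite !mops_functional_eq0 mulr1 mulr0 !add0r => <-.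
by rewrite -uQ1 addrK addrK.
Qed.

Lemma functional_linked_neq0 n : u (Q n.+2) != 0.
Proof.
elim: n => [|n IH]; first by rewrite functional_linked2 subr_eq0; case: hnd.
by rewrite functional_linked mulf_neq0 // oppr_eq0; case: (nondeg_neq0 n).
Qed.

Lemma functional_relation_exists :
  exists lambda a b c, functionals_related u v lambda a b c.
Proof.
have k1 : k 1 != 0 := mops_norm_neq0 hP 1.
have K2 : K 2 != 0 := mops_norm_neq0 hQ 2.
have K1 : K 1 != 0 := mops_norm_neq0 hQ 1.
have [r3 t3] := nondeg_neq0 0.
have U2 := functional_linked_neq0 0.
(* Each constant is forced by one test polynomial, in this order: [la] by R_3, [c] by Q_2, [a] by
   Q_1, [b] by Q_0. *)
pose la := r 3 * K 2 / (t 3 * k 1).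
have la0 : la != 0 by rewrite !mulf_neq0 // invr_neq0 // mulf_neq0.
pose c := (u ('X * Q 2%N) - v ('X * ('X * Q 2%N)) / la) / u (Q 2%N).
pose a := (la * (u ('X * Q 1%N) - c * u (Q 1%N)) - v ('X * ('X * Q 1%N))) / K 1.
pose b := la * (u 'X - c) - v ('X * 'X) - a * v 'X.
exists la, a, b, c; split=> // p; rewrite /fmul.
pose R n := if (n < 3)%N then Q n else Q n + r n *: Q n.-1.
have szR n : size (R n) = n.+1.
  rewrite /R; case: ifP => n3; first exact: (mops_size hQ).
  rewrite size_polyDl (mops_size hQ) //; apply: leq_ltn_trans (size_scale_leq _ _) _.
  by rewrite (mops_size hQ); case: n n3.
have monR n : R n \is monic.
  rewrite monicE /lead_coef szR /R /=; case: ifP => n3; first by rewrite (mops_coef hQ).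
  rewrite coefD coefZ (mops_coef hQ) [(Q _)`_n]nth_default ?mulr0 ?addr0 //.
  by rewrite (mops_size hQ); case: n n3.
apply: (monic_seq_ind (T := fun p => la * u (('X - c%:P) * p) =
   v (('X^2 + a *: 'X + b%:P) * p)) monR szR) (leqnn _).
- by rewrite !mulr0 !linear0 mulr0.
- move=> z p1 p2 e1 e2; rewrite !mulrDr -!scalerAr !linearD !scalarZ mulrDr.
  by rewrite mulrCA e1 e2.
move=> n _; rewrite fmul_linear fmul_quadratic /R; case: ltnP => [|n3].
  case: n => [|[|[|//]]] _.
  - by rewrite (mops0 hQ) !mulr1 hu1 hv1 /b; ring.
  - have vX : v ('X * Q 1%N) = K 1.
      by rewrite mulrC (mops_orth_le hQ) ?size_polyX // coefX mul1r.
    have -> : v (Q 1%N) = 0 by rewrite -[Q _]mulr1 (mops_orth_lt hQ) // size_poly1.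
    by rewrite vX /a; field.
  - have -> : v ('X * Q 2%N) = 0 by rewrite mulrC (mops_orth_lt hQ) ?size_polyX.
    have -> : v (Q 2%N) = 0 by rewrite -[Q _]mulr1 (mops_orth_lt hQ) // size_poly1.
    by rewrite /c; field; rewrite U2 la0.
case: n n3 => [|[|[|n]]] //= _.
rewrite -fmul_linear -fmul_quadratic.
rewrite {1}linkedSS fmul_linear !mulrDr -!scalerAr !linearD !scalarZ.
have -> : u ('X * P n.+3) = 0 by rewrite mulrC (mops_orth_lt hP) // size_polyX.
have -> : u ('X * P n.+2) = 0 by rewrite mulrC (mops_orth_lt hP) // size_polyX.
rewrite !mops_functional_eq0 (mops_mulX hPrec) !linearD !scalarZ.
rewrite !mops_functional_eq0.
have sz := size_quadratic a b.
rewrite [_ * Q n.+3]mulrC [_ * Q n.+2]mulrC (mops_orth_lt hQ) ?sz //.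
rewrite (mops_orth_le hQ) ?sz //.
(* What remains is la t_(n+3) ga_(n+1) <u, P_n> on the left and r_(n+3) K_(n+2) times the
   coefficient of x^(n+2) in phi on the right. Only n = 0 contributes, and it fixes [la]. *)
case: n => [|n].
  have := mops_normS hP hPrec 0; rewrite (mops0 hP) expr1n hu1 mulr1 -/(k 1) => <-.
  rewrite !coefD coefXn coefZ coefX coefC /= -/(K 2) /la.
  by field; rewrite t3 k1.
rewrite mops_functional_eq0 nth_default ?sz //; ring.
Qed.

(** * Identities forced by a given relation *)

Section Related.
Variables lambda a b c : F.
Hypothesis hrel : functionals_related u v lambda a b c.

Let relE p : lambda * u (('X - c%:P) * p) = v (('X^2 + a *: 'X + b%:P) * p).
Proof. by case: hrel => _; apply. Qed.

Lemma related_tga n : tga n.+3 = r n.+3 * (tbe n.+3 - c - r n.+4).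
Proof.
have [la0 _] := hrel.
have v0 : v (('X^2 + a *: 'X + b%:P) * Q n.+3) = 0.
  by rewrite mulrC (mops_orth_lt hQ) // size_quadratic.
move/eqP: v0; rewrite -relE mulf_eq0 (negPf la0) /= fmul_linear.
(* Every term becomes a multiple of <u, Q_(n+2)>, which is nonzero and cancels. *)
rewrite (mops_mulX hQrec) !linearD !scalarZ !functional_linked => /eqP e.
apply: (mulIf (functional_linked_neq0 n)); apply/eqP.
by rewrite -subr_eq0 -e; apply/eqP; ring.
Qed.

(** Test the relation at P_n R_(n+3). By degree, only t_(n+3) P_(n+1) survives under u and only
    r_(n+3) Q_(n+2) under v. *)
Lemma related_norm n : lambda * t n.+3 * k n.+1 = r n.+3 * K n.+2.
Proof.
pose phi := 'X^2 + a *: 'X + b%:P.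
have mP : P n \is monic by case: hP.
have sphi : size (phi * P n) = n.+3.
  by rewrite size_monicM ?monic_quadratic ?monic_neq0 // size_quadratic (mops_size hP).
have slin : size (('X - c%:P) * P n) = n.+2.
  by rewrite size_monicM ?monicXsubC ?monic_neq0 // size_XsubC (mops_size hP).
have := relE (P n * (Q n.+3 + r n.+3 *: Q n.+2)).
rewrite [in LHS]linkedSS !mulrA ![_ * (_ + _)]mulrDr -!scalerAr !linearD !scalarZ.
rewrite ![_ * P n * _]mulrC (mops_orth_lt hQ) ?sphi //.
rewrite (mops_orth_monic hQ) ?sphi // ?monicMl ?monic_quadratic //.
rewrite (mops_orth_lt hP (n := n.+3)) ?(mops_orth_lt hP (n := n.+2)) ?slin //.
rewrite (mops_orth_monic hP) ?slin // ?monicMl ?monicXsubC // -/(k _) -/(K _).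
by rewrite mulr0 !add0r => <-; ring.
Qed.

(** Since tga_(n+3) = r_(n+3) z with z = tbe_(n+3) - c - r_(n+4), the recurrence for Q regroups as
    R_(n+4) + z R_(n+3). *)
Lemma related_mulX n :
  ('X - c%:P) * Q n.+3
  = P n.+4 + s n.+4 *: P n.+3 + t n.+4 *: P n.+2
    + (tbe n.+3 - c - r n.+4) *: (P n.+3 + s n.+3 *: P n.+2 + t n.+3 *: P n.+1).
Proof.
rewrite -!linkedSS mulrBl (mops_mulX hQrec) related_tga -!mul_polyC.
by rewrite !polyCB !polyCM !polyCB; ring.
Qed.

(** * Pairings of the two sequences under v *)

Let vPQ1 n : v (P n * Q n.+1) = 0.
Proof. by rewrite mulrC (mops_orth_lt hQ) // (mops_size hP). Qed.

Let vPQ2 n : v (P n * Q n.+2) = 0.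
Proof. by rewrite mulrC (mops_orth_lt hQ) // (mops_size hP). Qed.

Let vPQ3 n : v (P n * Q n.+3) = 0.
Proof. by rewrite mulrC (mops_orth_lt hQ) // (mops_size hP) ltnW. Qed.

Let vPQ n : v (P n * Q n) = K n.
Proof.
by rewrite mulrC (mops_orth_monic hQ) ?(mops_size hP) //; case: hP.
Qed.

Let vQ1Q n : v (Q n.+1 * Q n) = 0. Proof. exact: (mops_orth hQ). Qed.
Let vQ2Q n : v (Q n.+2 * Q n) = 0. Proof. exact: (mops_orth hQ). Qed.

(** When the index of P exceeds that of Q, the pairing need not vanish; it is solved from the
    linking relation multiplied by Q_(n+1). *)
Let vP1Q n : v (P n.+2 * Q n.+1) = (r n.+2 - s n.+2) * K n.+1.
Proof.
have := congr1 (fun p => v (p * Q n.+1)) (linkedSS n).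
rewrite !mulrDl -!scalerAl !linearD !scalarZ /= vQ1Q vPQ vPQ1 -expr2 -/(K _).
by move/eqP; rewrite -subr_eq0 => /eqP e; apply: subr0_eq; rewrite -[RHS]oppr0 -e; ring.
Qed.

Let vP2Q n : v (P n.+3 * Q n.+1) = - s n.+3 * (r n.+2 - s n.+2) * K n.+1
  - t n.+3 * K n.+1.
Proof.
have := congr1 (fun p => v (p * Q n.+1)) (linkedSS n.+1).
rewrite !mulrDl -!scalerAl !linearD !scalarZ /= vQ2Q vQ1Q vP1Q vPQ.
by move/eqP; rewrite -subr_eq0 => /eqP e; apply: subr0_eq; rewrite -[RHS]oppr0 -e; ring.
Qed.

Lemma related_quadratic_mulP n :
  ('X^2 + a *: 'X + b%:P) * P n.+2
  = P n.+4 + (be n.+3 + be n.+2 + a) *: P n.+3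
    + (ga n.+3 + ga n.+2 + be n.+2 ^+ 2 + a * be n.+2 + b) *: P n.+2
    + (ga n.+2 * (be n.+2 + be n.+1 + a)) *: P n.+1
    + (ga n.+2 * ga n.+1) *: P n.
Proof.
rewrite !mulrDl expr2 -mulrA -scalerAl mul_polyC.
rewrite (mops_mulX hPrec n.+1) !mulrDr -!scalerAr !(mops_mulX hPrec).
by rewrite -!mul_polyC !(polyCD, polyCM); ring.
Qed.

Let uPP1 n : u (P n * P n.+1) = 0.
Proof. by rewrite mulrC (mops_orth hP). Qed.
Let uPP2 n : u (P n * P n.+2) = 0.
Proof. by rewrite mulrC (mops_orth hP). Qed.
Let uP1P n : u (P n.+1 * P n) = 0.
Proof. by rewrite (mops_orth hP). Qed.
Let uP2P n : u (P n.+2 * P n) = 0.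
Proof. by rewrite (mops_orth hP). Qed.

Let uPP n : u (P n * P n) = k n. Proof. by []. Qed.

(** * Comparison of the relation on products of P and Q *)

Lemma related_s n :
  t n.+3 * (be n.+3 + be n.+2 + a - s n.+4) = s n.+3 * ga n.+2.
Proof.
have := relE (P n.+2 * Q n.+3).
rewrite mulrCA related_mulX mulrA related_quadratic_mulP.
rewrite !mulrDr !mulrDl -?scalerAr -?scalerAl !mulrDr -?scalerAr !linearD !scalarZ.
rewrite !(uPP1, uPP2, uP1P, uPP) !(vPQ1, vPQ2, vPQ3, vPQ, vP1Q) => e.
have K0 : K n.+3 != 0 := mops_norm_neq0 hQ _.
have eK : K n.+3 = tga n.+3 * K n.+2 := mops_normS hQ hQrec _.
have ek : k n.+2 = ga n.+2 * k n.+1 := mops_normS hP hPrec _.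
have e0 := related_norm n; have e1 := related_norm n.+1.
rewrite related_tga in eK.
(* By [related_tga], [z] is tga_(n+3) / r_(n+3). *)
pose z := tbe n.+3 - c - r n.+4; rewrite -/z in e eK.
apply: (mulIf K0).
apply: (eq_lincomb (congr2 +%R (congr1 ( *%R (- t n.+3)) e)
  (congr2 +%R (congr1 ( *%R (t n.+3)) e1)
  (congr1 ( *%R (z * s n.+3 * ga n.+2)) e0)))).
by rewrite /= ek eK; ring.
Qed.

(** The test polynomial P_(n+3) Q_(n+3) brings in b through the diagonal coefficient of phi P_(n+3).
    The norms and [lambda] are then eliminated by [related_norm], and a term in s_(n+5) by
    [related_s]. *)
Lemma related_quadratic_coef n :
  ga n.+4 + ga n.+3 + be n.+3 ^+ 2 + a * be n.+3 + b
  = t n.+4.+1 + s n.+4 * (be n.+4 + be n.+3 + a - s n.+4.+1) + ga n.+3 * ga n.+2 / t n.+3.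
Proof.
have := relE (P n.+3 * Q n.+3).
rewrite mulrCA related_mulX mulrA related_quadratic_mulP.
rewrite !mulrDr !mulrDl -?scalerAr -?scalerAl !mulrDr -?scalerAr !linearD !scalarZ.
rewrite !(uPP1, uPP2, uP1P, uP2P, uPP) !(vPQ1, vPQ2, vPQ3, vPQ, vP1Q, vP2Q) => e.
have K0 : K n.+3 != 0 := mops_norm_neq0 hQ _.
have eK : K n.+3 = tga n.+3 * K n.+2 := mops_normS hQ hQrec _.
have ek : k n.+2 = ga n.+2 * k n.+1 := mops_normS hP hPrec _.
have ek' : k n.+3 = ga n.+3 * k n.+2 := mops_normS hP hPrec _.
have e0 := related_norm n; have e1 := related_norm n.+1.
have es := related_s n.+1.
have [[_ t3] [_ t4]] := (nondeg_neq0 n, nondeg_neq0 n.+1).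
rewrite related_tga in eK.
pose z := tbe n.+3 - c - r n.+4; rewrite -/z in e eK.
have es' : be n.+4 + be n.+3 + a - s n.+4.+1 = s n.+4 * ga n.+3 / t n.+4.
  by rewrite -es mulrAC divff // mul1r.
have e1' : lambda * k n.+2 = r n.+4 * K n.+3 / t n.+4 by rewrite -e1; field.
have e0' : lambda * k n.+1 = r n.+3 * K n.+2 / t n.+3 by rewrite -e0; field.
apply: (mulIf K0).
apply: (eq_lincomb (congr2 +%R (congr1 -%R e)
  (congr2 +%R (congr1 ( *%R (- r n.+4 * K n.+3)) es')
  (congr2 +%R (congr1 ( *%R (s n.+4 * ga n.+3)) e1')
  (congr1 ( *%R (z * ga n.+3 * ga n.+2)) e0'))))).
by rewrite /= ek' ek eK; field; rewrite t3 t4.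
Qed.

Lemma related_a n : seq_a be ga s t n.+4 * t n.+3 = t n.+4 * ga n.+2.
Proof.
have eX : 'X * (Q n.+4 + r n.+4 *: Q n.+3) - (Q n.+4.+1 + r n.+4.+1 *: Q n.+4)
  = 'X * (P n.+4 + s n.+4 *: P n.+3 + t n.+4 *: P n.+2)
    - (P n.+4.+1 + s n.+4.+1 *: P n.+4 + t n.+4.+1 *: P n.+3).
  by rewrite !linkedSS.
(* This is x R_(n+4) - R_(n+5) in the bases Q and P; the terms of degree n+5 cancel. *)
have {}eX : (tbe n.+4 + r n.+4 - r n.+4.+1) *: Q n.+4
    + (tga n.+4 + r n.+4 * tbe n.+3) *: Q n.+3 + (r n.+4 * tga n.+3) *: Q n.+2
  = (be n.+4 + s n.+4 - s n.+4.+1) *: P n.+4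
    + (ga n.+4 + s n.+4 * be n.+3 + t n.+4 - t n.+4.+1) *: P n.+3
    + (s n.+4 * ga n.+3 + t n.+4 * be n.+2) *: P n.+2
    + (t n.+4 * ga n.+2) *: P n.+1.
  apply: (eq_lincomb eX).
  rewrite !mulrDr -!scalerAr !(mops_mulX hPrec) !(mops_mulX hQrec).
  by rewrite -!mul_polyC !(polyCB, polyCD, polyCM); ring.
have K0 m : K m != 0 := mops_norm_neq0 hQ _.
have vQQ m : v (Q m * Q m) = K m by [].
have vQQ1 m : v (Q m * Q m.+1) = 0 by rewrite mulrC vQ1Q.
have vQQ2 m : v (Q m * Q m.+2) = 0 by rewrite mulrC vQ2Q.
have e4 := congr1 (fun p => v (p * Q n.+4)) eX.
rewrite /= !mulrDl -!scalerAl !linearD !scalarZ in e4.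
rewrite vQQ vQQ1 vQQ2 vPQ !(vPQ1, vPQ2, vPQ3) !mulr0 !addr0 in e4.
have {}e4 := mulIf (K0 _) e4.
have e3 := congr1 (fun p => v (p * Q n.+3)) eX.
rewrite /= !mulrDl -!scalerAl !linearD !scalarZ in e3.
rewrite vQ1Q vQQ vQQ1 vP1Q vPQ !(vPQ1, vPQ2) in e3.
have eK : K n.+3 = tga n.+3 * K n.+2 := mops_normS hQ hQrec _.
have ek : k n.+2 = ga n.+2 * k n.+1 := mops_normS hP hPrec _.
have e0 := related_norm n; have e1 := related_norm n.+1.
have tg := related_tga n.+1.
rewrite related_tga in eK.
pose z := tbe n.+3 - c - r n.+4; rewrite -/z in eK.
(* Pairing with Q_(n+4) and Q_(n+3) gave the two top coefficients; r_(n+4) times the first,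
   subtracted from the second, leaves exactly a_(n+4). *)
have ea : seq_a be ga s t n.+4 = r n.+4 * z.
  rewrite tg in e3; apply: (mulIf (K0 n.+3)).
  apply: (eq_lincomb (congr2 +%R (congr1 -%R e3)
    (congr1 ( *%R (r n.+4 * K n.+3)) e4))).
  by rewrite /= /seq_a /z /=; ring.
(* The ratio of [related_norm] at n+1 and n gives t_(n+4) ga_(n+2) = r_(n+4) z t_(n+3). *)
apply: (mulIf (K0 n.+3)).
apply: (eq_lincomb (congr2 +%R (congr1 ( *%R (- z * t n.+3)) e1)
  (congr1 ( *%R (z * t n.+4 * ga n.+2)) e0))).
by rewrite /= ea ek eK; ring.
Qed.

(** * Values of the three sequences *)

Lemma related_seq_a n : seq_a be ga s t n.+4 / t n.+4 = ga n.+2 / t n.+3.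
Proof.
have [[_ t3] [_ t4]] := (nondeg_neq0 n, nondeg_neq0 n.+1).
by apply/eqP; rewrite eqr_div // related_a mulrC.
Qed.

Lemma seq_A_related n : seq_A be ga s t n.+3 = a.
Proof.
have [_ t3] := nondeg_neq0 n; have es := related_s n.
rewrite /seq_A -mulrA related_seq_a /= mulrA -es; field; exact: t3.
Qed.

Lemma seq_B_related n : seq_B be ga s t n.+3 = b.
Proof.
have [[_ t3] [_ t4]] := (nondeg_neq0 n, nondeg_neq0 n.+1).
have eb := related_quadratic_coef n; have ea := related_a n.
rewrite /seq_B -!mulrA related_seq_a.
have {}ea : seq_a be ga s t n.+4 = t n.+4 * (ga n.+2 / t n.+3).
  by rewrite mulrA -ea mulfK.
have eA := seq_A_related n; rewrite /seq_A -mulrA related_seq_a in eA.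
(* With a replaced by its expression, the unfolded a_(n+4) in [ea] removes ga_(n+4), be_(n+4),
   s_(n+5) and t_(n+5) from [eb]. *)
rewrite -{}eA in eb; rewrite /seq_a /= in ea.
apply: (eq_lincomb (congr2 +%R (congr1 -%R eb) ea)).
by rewrite /seq_a /=; field; rewrite t3.
Qed.

Lemma seq_C_related n : seq_C tbe tga r n.+3 = c.
Proof.
have [r3 _] := nondeg_neq0 n.
by rewrite /seq_C related_tga; field.
Qed.

End Related.

End Linked.

Theorem theorem3p3 (R : realType)
    (u v : {scalar {poly R[i]}}) (P Q : nat -> {poly R[i]})
    (be ga tbe tga r s t : nat -> R[i])
    (hP : is_MOPS u P) (hQ : is_MOPS v Q)
    (hu1 : u 1 = 1) (hv1 : v 1 = 1)
    (hPrec : is_recurrence_coefs P be ga)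
    (hQrec : is_recurrence_coefs Q tbe tga)
    (hlink : linked23 P Q r s t)
    (hnd : nondegenerate23 r s t) :
  (exists lambda a b c : R[i], functionals_related u v lambda a b c) /\
  (forall lambda a b c : R[i], functionals_related u v lambda a b c ->
   forall n : nat, (3 <= n)%N ->
     [/\ seq_A be ga s t n = a,
         seq_B be ga s t n = b
       & seq_C tbe tga r n = c]).
Proof.
split; first exact: (functional_relation_exists hP hQ hu1 hv1 hPrec hlink hnd).
move=> lambda a b c hrel [|[|[|n]]] // _; split.
- exact: (seq_A_related hP hQ hu1 hPrec hQrec hlink hnd hrel).
- exact: (seq_B_related hP hQ hu1 hPrec hQrec hlink hnd hrel).
- exact: (seq_C_related hP hQ hu1 hQrec hlink hnd hrel).
Qed.
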